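(* For any $n\geq 1$, the map $\lambda$ is an EL-labeling of the cubic coordinate poset $\mathsf{CC}(n)$. Moreover, there is at most one $\lambda$-decreasing saturated chain between any pair of elements of $\mathsf{CC}(n)$.
   Context: For integers $i,j$, $[i,j]=\{i,i+1,\dots,j\}$ and $[i]=[1,i]$. A Tamari diagram of size $n$ is a word $u$ of length $n$ on $\mathbb{N}=\{0,1,2,\dots\}$ such that $0\leq u_i\leq n-i$ for all $i\in[n]$ and $u_{i+j}\leq u_i-j$ for all $i\in[n]$, $j\in[0,u_i]$. A dual Tamari diagram of size $n$ is a word $v$ of length $n$ on $\mathbb{N}$ such that $0\leq v_i\leq i-1$ for all $i\in[n]$ and $v_{i-j}\leq v_i-j$ for all $i\in[n]$, $j\in[0,v_i]$. They are compatible if there are no $1\leq i<j\leq n$ with $u_i\geq j-i$ and $v_j\geq j-i$. A Tamari interval diagram of size $n$ is a pair $(u,v)$ of compatible Tamari and dual Tamari diagrams of size $n$. A cubic coordinate of size $n$ is an $(n-1)$-tuple of integers of the form $(u_1-v_2,\dots,u_{n-1}-v_n)$ with $(u,v)$ a Tamari interval diagram of size $n$; $\mathsf{CC}(n)$ is the set of these, ordered by $c\preccurlyeq c'$ iff $c_i\leq c'_i$ for all $i\in[n-1]$. This poset is bounded. Write $c\lessdot c'$ if $c'$ covers $c$; in that case $c$ and $c'$ differ in exactly one component. The map $\lambda$ assigns to each covering pair $c\lessdot c'$ the label $\lambda(c,c'):=(\varepsilon,i,c_i)\in\mathbb{Z}^3$, where $i\in[n-1]$ is the unique index with $c_i<c'_i$,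 and $\varepsilon=-1$ if $c_i<0$, $\varepsilon=1$ otherwise. The set $\mathbb{Z}^3$ is ordered lexicographically. For a bounded poset $\mathcal P$ and a map $\lambda$ from its set of covering pairs to a poset $\Lambda$, the image of a saturated chain $(x^{(1)},\dots,x^{(k)})$ is the word $(\lambda(x^{(1)},x^{(2)}),\dots,\lambda(x^{(k-1)},x^{(k)}))$. The chain is $\lambda$-increasing (resp. $\lambda$-decreasing) if this word is increasing (resp. decreasing) in $\Lambda$. One saturated chain is $\lambda$-smaller than another if its image is smaller for the lexicographic order on words induced by the order of $\Lambda$. The map $\lambda$ is an EL-labeling of $\mathcal P$ if for all $x\preccurlyeq y$ in $\mathcal P$ there is exactly one $\lambda$-increasing saturated chain from $x$ to $y$, and this chain is $\lambda$-minimal among all saturated chains from $x$ to $y$. *)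

(* Defs.v *)
From HB Require Import structures.
From mathcomp Require Import all_boot all_order all_algebra zify.
From mathcomp Require Import boolp.

Set Implicit Arguments.
Unset Strict Implicit.
Unset Printing Implicit Defensive.

Import Order.TTheory GRing.Theory.

Local Open Scope order_scope.

Section ELLabeling.
Context (d d' : Order.disp_t) (P : porderType d) (L : porderType d').
Implicit Types (lam : P -> P -> L) (x y : P) (s : seq P).

Definition covers x y : bool :=
  `[< x < y /\ (forall z : P, ~ (x < z /\ z < y)) >].

(* A chain is given by its first element [x] and the sequence [s] of the
   following ones, as in [path]. *)
Definition saturated_chain x y s : Prop := path covers x s /\ last x s = y.

(* An edge labeling is a total function on pairs, of which only the values on
   covering pairs are used. *)
Definition chain_image lam x s : seq L := pairmap lam x s.

(* Strict; for [CC_label] below this agrees with the weak version, as a label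
   never occurs twice along a saturated chain. *)
Definition increasing_chain lam x s : Prop :=
  sorted (fun a b : L => a < b) (chain_image lam x s).

Definition decreasing_chain lam x s : Prop :=
  sorted (fun a b : L => b < a) (chain_image lam x s).

(* Lexicographic order on words over [L]. *)
Definition chain_smaller lam x s s' : Prop :=
  (chain_image lam x s : seqlexi L) < (chain_image lam x s' : seqlexi L).

End ELLabeling.

(* Minimality is strict: the image of the increasing chain precedes the image
   of every other saturated chain. *)
Definition EL_labeling (d d' : Order.disp_t) (P : tbPOrderType d)
    (L : porderType d') (lam : P -> P -> L) : Prop :=
  forall x y : P, x <= y ->
  exists s : seq P,
    [/\ saturated_chain x y s,
        increasing_chain lam x s,
        forall s' : seq P,
          saturated_chain x y s' -> increasing_chain lam x s' -> s' = s
      & forall s' : seq P,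
          saturated_chain x y s' -> s' <> s -> chain_smaller lam x s s'].

(* Letters of words are indexed from 1; only used with [1 <= i]. *)
Definition letter (w : seq nat) (i : nat) : nat := nth 0%N w i.-1.

(* In both definitions the subtraction of [j] is never truncated. *)
Definition tamari_diagram (n : nat) (u : n.-tuple nat) : Prop :=
  forall i : nat, (1 <= i <= n)%N ->
    (letter u i <= n - i)%N /\
    (forall j : nat, (j <= letter u i)%N ->
       (letter u (i + j) <= letter u i - j)%N).

Definition dual_tamari_diagram (n : nat) (v : n.-tuple nat) : Prop :=
  forall i : nat, (1 <= i <= n)%N ->
    (letter v i <= i - 1)%N /\
    (forall j : nat, (j <= letter v i)%N ->
       (letter v (i - j) <= letter v i - j)%N).

Definition compatible (n : nat) (u v : n.-tuple nat) : Prop :=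
  ~ exists i j : nat,
      [/\ (1 <= i)%N, (i < j)%N, (j <= n)%N,
          (j - i <= letter u i)%N & (j - i <= letter v j)%N].

Definition tamari_interval_diagram (n : nat) (u v : n.-tuple nat) : Prop :=
  [/\ tamari_diagram u, dual_tamari_diagram v & compatible u v].

(* The entry of index [i : 'I_n.-1] is the component numbered [i.+1], namely
   [u_(i.+1) - v_(i.+2)].  [tupleprod] carries the componentwise order. *)
Definition coordinate_tuple (n : nat) (u v : n.-tuple nat) :
    n.-1.-tupleprod int :=
  [tuple ((letter u i.+1)%:Z - (letter v i.+2)%:Z)%R | i < n.-1].

Definition cubic_coordinate (n : nat) (c : n.-1.-tupleprod int) : Prop :=
  exists u v : n.-tuple nat,
    tamari_interval_diagram u v /\ c = coordinate_tuple u v.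

Record CC (n : nat) := MkCC {
  CC_val :> n.-1.-tupleprod int;
  _ : `[< cubic_coordinate CC_val >] }.

Fact CC_display : Order.disp_t. Proof. exact: (Order.Disp tt tt). Qed.

HB.instance Definition _ (n : nat) := [isSub for @CC_val n].
HB.instance Definition _ (n : nat) := [Choice of CC n by <:].
HB.instance Definition _ (n : nat) :=
  [SubChoice_isSubPOrder of CC n by <: with CC_display].

Definition CC_comp (n : nat) (c : CC n) (i : 'I_n.-1) : int :=
  tnth (CC_val c) i.

Lemma CC_leP (n : nat) (c c' : CC n) :
  reflect (forall i : 'I_n.-1, (CC_comp c i <= CC_comp c' i)%R) (c <= c').
Proof.
rewrite leEsub leEtprod.
exact: (iffP forallP).
Qed.

Section Bounds.
Variable n : nat.

Let bot_u : n.-tuple nat := [tuple 0%N | i < n].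
Let bot_v : n.-tuple nat := [tuple nat_of_ord i | i < n].
Let top_u : n.-tuple nat := [tuple (n - i.+1)%N | i < n].
Let top_v : n.-tuple nat := [tuple 0%N | i < n].

Let letter_mk (f : nat -> nat) (i : nat) : (1 <= i <= n)%N ->
  letter [tuple f i | i < n] i = f i.-1.
Proof.
case: i => // i /= lt_in.
exact: (nth_mktuple _ 0%N (Ordinal lt_in)).
Qed.

Let letter_zero (i : nat) : letter [tuple 0%N | i < n] i = 0%N.
Proof.
rewrite /letter; case: (ltnP i.-1 n) => [lt_in|le_ni].
  exact: (nth_mktuple _ 0%N (Ordinal lt_in)).
by rewrite nth_default // size_tuple.
Qed.

Fact CC_bot_subproof : `[< cubic_coordinate (coordinate_tuple bot_u bot_v) >].
Proof.
apply/asboolP; exists bot_u, bot_v; split=> //; split.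
- by move=> i _; rewrite !letter_zero; split=> // j _; rewrite letter_zero.
- move=> i Hi; rewrite (letter_mk (fun i => i)) //; split; first lia.
  move=> j Hj; rewrite (letter_mk (fun i => i)); lia.
- by case=> i [j] [? ? ?]; rewrite letter_zero; lia.
Qed.

Fact CC_top_subproof : `[< cubic_coordinate (coordinate_tuple top_u top_v) >].
Proof.
apply/asboolP; exists top_u, top_v; split=> //; split.
- move=> i Hi; rewrite (letter_mk (fun i => n - i.+1)%N) //; split; first lia.
  move=> j Hj; rewrite (letter_mk (fun i => n - i.+1)%N); lia.
- by move=> i _; rewrite !letter_zero; split=> // j _; rewrite letter_zero.
- by case=> i [j] [? ? ?] _; rewrite letter_zero; lia.
Qed.

Let CC_bounds (c : CC n) (i : 'I_n.-1) :
  (- (i.+1)%:Z <= CC_comp c i <= (n - i.+1)%N%:Z)%R.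
Proof.
case: c => c /[dup] /asboolP[u [v [[tu tv _] ->]]] Hc.
rewrite /CC_comp tnth_mktuple; have := ltn_ord i => lt_in.
have [|ui _] := tu i.+1; first lia.
have [|vi _] := tv i.+2; first lia.
lia.
Qed.

Definition CC_bot : CC n := MkCC CC_bot_subproof.
Definition CC_top : CC n := MkCC CC_top_subproof.

Fact CC_le0x (c : CC n) : CC_bot <= c.
Proof.
apply/CC_leP => i; have := CC_bounds c i; have := ltn_ord i => lt_in.
have -> : CC_comp CC_bot i = (- (i.+1)%:Z)%R; last lia.
by rewrite /CC_comp tnth_mktuple letter_zero (letter_mk (fun i => i)); lia.
Qed.

Fact CC_lex1 (c : CC n) : c <= CC_top.
Proof.
apply/CC_leP => i; have := CC_bounds c i; have := ltn_ord i => lt_in.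
have -> : CC_comp CC_top i = ((n - i.+1)%N%:Z)%R; last lia.
rewrite /CC_comp tnth_mktuple letter_zero.
by rewrite (letter_mk (fun i => n - i.+1)%N); lia.
Qed.

HB.instance Definition _ := Order.hasBottom.Build CC_display (CC n) CC_le0x.
HB.instance Definition _ := Order.hasTop.Build CC_display (CC n) CC_lex1.

End Bounds.

(* [*l] is the product with the lexicographic order. *)
Definition Z3 : Type := (int *l int *l int)%type.

(* On a covering pair exactly one component increases, so that [pick] returns
   that component; the default value is never used on covering pairs. *)
Definition CC_label (n : nat) (c c' : CC n) : Z3 :=
  match [pick i : 'I_n.-1 | (CC_comp c i < CC_comp c' i)%R] with
  | Some i =>
      ((if (CC_comp c i < 0)%R then (-1)%R else 1%R : int),
       ((i.+1)%:Z)%R,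
       CC_comp c i)
  | None => ((0 : int)%R, (0 : int)%R, (0 : int)%R)
  end.

(* Main.v *)
Require Import Defs.
From mathcomp Require Import all_boot all_order all_algebra.
From mathcomp Require Import boolp zify.

Set Implicit Arguments.
Unset Strict Implicit.
Unset Printing Implicit Defensive.

Import Order.TTheory GRing.Theory Num.Theory.

(** Write [x_i = u_i - v_(i+1)], numbered from 1, for the components of [x], and
    attach to each index [i] the label
    [comp_label x i = (sign of x_i, i, x_i)], the sign of 0 being 1.
    When [x < y], call [i] raised if [x_i < y_i].  A saturated
    chain from [x] to [y] must raise each such
    component at some point, and the first time it does so the component still
    has the value [x_i]; so every label [comp_label x i], with [i] raised,
    occurs in the image of every saturated chain ([first_raise_label]), and the
    first label of the chain is one of these.

    The only fact about Tamari interval diagrams behind the theorem is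
    [raise_first]: if [i] is the raised index of least label, then some
    [z <= y] in the poset is obtained from [x] by raising the component [i]
    alone.  A diagram [(u, v)] is made of two families of nested intervals,
    [[j, j + u_j]] and [[j - v_j, j]].  If [x_i < 0], the least label means that
    [v] already has its final values to the left of the letter [i + 1], which
    can then be replaced by that of [y] without breaking nestedness; if
    [x_i >= 0], the whole of [v] is final, and so is [u] to the left of the
    letter [i], which can be replaced by that of [y].

    Since components are integers, raising by the least possible amount gives
    a cover.  Hence each cover raises exactly one component, and a cover of [x]
    is determined by the component that it raises.

    An increasing chain starts with a label below all the others, hence with the
    least [comp_label x i] among raised [i]: its first step is forced, and so,
    by induction, is the whole chain.  Taking at each step the cover with the
    least label does give an increasing chain, because raising the component
    [i] changes only the label of [i], and increases it.  Any other saturated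
    chain has, at the first step where it differs, a larger label.  Dually, a
    decreasing chain starts with the greatest [comp_label x i] among raised
    [i], which forces each of its steps. *)

(** * Tamari interval diagrams *)

Section Diagrams.
Variable n : nat.
Implicit Types u v w : n.-tuple nat.

Definition set_letter w (p t : nat) : n.-tuple nat :=
  [tuple if k.+1 == p then t else letter w k.+1 | k < n].

Lemma letter_set w p t i : (1 <= i <= n)%N ->
  letter (set_letter w p t) i = if i == p then t else letter w i.
Proof.
case: i => // i /= lt_in.
exact: (nth_mktuple (fun k : 'I_n => if k.+1 == p then t else letter w k.+1)
  0%N (Ordinal lt_in)).
Qed.

Lemma coordinate_tupleE u v (i : 'I_n.-1) :
  tnth (coordinate_tuple u v) i
    = ((letter u i.+1)%:Z - (letter v i.+2)%:Z)%R.
Proof. by rewrite tnth_mktuple. Qed.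

(** Compatibility at two consecutive indices: this is why a cubic coordinate
    determines its diagram, its components being [u_i] when nonnegative and
    [- v_(i+1)] when negative. *)
Lemma compatible_disjoint u v i : compatible u v -> (1 <= i < n)%N ->
  letter u i = 0%N \/ letter v i.+1 = 0%N.
Proof.
move=> cuv Hi; case: (posnP (letter u i)) => [|u0]; first by left.
case: (posnP (letter v i.+1)) => [|v0]; first by right.
by case: cuv; exists i, i.+1; split; lia.
Qed.

Lemma letter_dual1 v : dual_tamari_diagram v -> (0 < n)%N -> letter v 1 = 0%N.
Proof. by move=> dv n0; have [|] := dv 1%N; lia. Qed.

(** The intervals [[j - v_j, j]] stay nested: the only interval to change now
    has its left end where it is in [v'], and the intervals ending to the left
    of [q] are those of [v']; the ones that contained it still do, since it
    shrinks. *)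
Lemma set_letter_dual v v' q : (1 <= q <= n)%N ->
  dual_tamari_diagram v -> dual_tamari_diagram v' ->
  (letter v' q <= letter v q)%N ->
  (forall j, (1 <= j < q)%N -> letter v j = letter v' j) ->
  dual_tamari_diagram (set_letter v q (letter v' q)).
Proof.
move=> Hq dv dv' le_v eq_v i Hi; have [vi vij] := dv i Hi.
have [v'i v'ij] := dv' i Hi.
split=> [|j]; rewrite letter_set //; first by case: eqP => [<-|].
case: eqP => [iq|niq] Hj.
  subst q; rewrite letter_set; last lia.
  case: eqP => [?|nij]; first by (have -> : j = 0%N by lia); rewrite subn0.
  by rewrite eq_v; [apply: v'ij|lia].
rewrite letter_set; last lia.
case: eqP => [ijq|_]; last exact: vij.
by apply: leq_trans (vij j Hj); rewrite ijq.
Qed.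

(** The intervals [[j, j + u_j]] stay nested: the one starting at [p] becomes
    that of [u'], which contains the smaller intervals of [u] that start inside
    it, and it lies in the intervals starting to the left of [p] that contain
    [p], because these are those of [u']. *)
Lemma set_letter_tamari u u' p : (1 <= p <= n)%N ->
  tamari_diagram u -> tamari_diagram u' ->
  (forall j, (1 <= j <= n)%N -> letter u j <= letter u' j)%N ->
  (forall j, (1 <= j < p)%N -> letter u j = letter u' j) ->
  tamari_diagram (set_letter u p (letter u' p)).
Proof.
move=> Hp tu tu' le_u eq_u i Hi; have [ui uij] := tu i Hi.
have [u'i u'ij] := tu' i Hi.
split=> [|j]; rewrite letter_set //; first by case: eqP => [<-|].
case: eqP => [ip|nip] Hj.
  subst p; rewrite letter_set; last lia.
  case: eqP => [?|nij]; first by (have -> : j = 0%N by lia); rewrite subn0.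
  by apply: leq_trans (u'ij j Hj); apply: le_u; lia.
rewrite letter_set; last lia.
case: eqP => [ijp|_]; last exact: uij.
by rewrite -ijp eq_u; [apply: u'ij; rewrite -eq_u|]; lia.
Qed.

(** The hypotheses on letters are what the componentwise comparison of the
    cubic coordinates of [(u, v)] and [(u', v')] gives on diagrams. *)
Section Replacement.
Variables u v u' v' : n.-tuple nat.
Hypotheses (T : tamari_interval_diagram u v)
           (T' : tamari_interval_diagram u' v').
Hypothesis le_uu' : forall j, (1 <= j <= n)%N -> (letter u j <= letter u' j)%N.
Hypothesis le_vv' : forall j, (1 <= j <= n)%N -> (letter v' j <= letter v j)%N.

Lemma set_dual_interval q : (1 <= q <= n)%N ->
  (forall j, (1 <= j < q)%N -> letter v j = letter v' j) ->
  tamari_interval_diagram u (set_letter v q (letter v' q)).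
Proof.
case: T T' => tu dv cuv [tu' dv' _] Hq eq_v; split=> //.
  exact: (set_letter_dual _ _ dv' (le_vv' Hq)).
case=> i [j] [? ? ? uij]; rewrite letter_set; last lia.
move=> vij; case: cuv; exists i, j; split=> //; apply: leq_trans vij _.
by case: eqP => [->|//]; apply: le_vv'.
Qed.

(** Since [v] and [v'] agree, compatibility comes from [(u', v')], as the new
    word is below [u']. *)
Lemma set_tamari_interval p : (1 <= p <= n)%N ->
  (forall j, (1 <= j < p)%N -> letter u j = letter u' j) ->
  (forall j, (1 <= j <= n)%N -> letter v j = letter v' j) ->
  tamari_interval_diagram (set_letter u p (letter u' p)) v.
Proof.
case: T T' => tu dv cuv [tu' dv' cuv'] Hp eq_u eq_v; split=> //.
  exact: set_letter_tamari.
case=> i [j] [? ? ?]; rewrite letter_set; last lia.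
move=> uij vij; case: cuv'; exists i, j; split=> //; last by rewrite -eq_v; lia.
by apply: leq_trans uij _; case: eqP => [->|_] //; apply: le_uu'; lia.
Qed.

End Replacement.
End Diagrams.

(** * Cubic coordinates and their labels *)

Section Labels.
Variable n : nat.
Implicit Types (x y z : CC n) (i k : 'I_n.-1) (s : seq (CC n)).

Definition comp_label x i : Z3 :=
  ((if (CC_comp x i < 0)%R then (-1)%R else 1%R : int),
   ((i.+1)%:Z)%R, CC_comp x i).

Definition raised x y i : bool := (CC_comp x i < CC_comp y i)%R.

Definition raises_only i x y : Prop :=
  raised x y i /\ forall k, k != i -> CC_comp y k = CC_comp x k.

Lemma comp_label_le x i y k : (comp_label x i <= comp_label y k)%O =
  let e c : int := if (c < 0)%R then (-1)%R else 1%R in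
  let a := CC_comp x i in let b := CC_comp y k in
  (e a < e b)%R || (e a == e b) && ((i < k)%N || (i == k) && (a <= b)%R).
Proof.
rewrite /comp_label !lexi_pair /=.
have -> : (i == k) = (i == k :> nat) by [].
do 2 case: ifP => _; lia.
Qed.

Lemma CCP x : exists u v : n.-tuple nat, [/\ tamari_interval_diagram u v,
  (forall i, CC_comp x i = ((letter u i.+1)%:Z - (letter v i.+2)%:Z)%R)
  & forall i, letter u i.+1 = 0%N \/ letter v i.+2 = 0%N].
Proof.
case: x => c Hc; have [u [v [T c_uv]]] := elimT (asboolP _) Hc.
exists u, v; split=> // i; first by rewrite /CC_comp /= c_uv coordinate_tupleE.
by case: T => _ _ cuv; apply: compatible_disjoint => //; have := ltn_ord i; lia.
Qed.

Definition CC_of u v (T : @tamari_interval_diagram n u v) : CC n :=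
  MkCC (asboolT (ex_intro _ u (ex_intro _ v (conj T erefl)))).

Lemma CC_of_comp u v (T : @tamari_interval_diagram n u v) i :
  CC_comp (CC_of T) i = ((letter u i.+1)%:Z - (letter v i.+2)%:Z)%R.
Proof. exact: coordinate_tupleE. Qed.

Lemma CC_eqP x y : (forall i, CC_comp x i = CC_comp y i) -> x = y.
Proof. by move=> eq_xy; apply/val_inj/eq_from_tnth. Qed.

Lemma lt_raised x y : (x < y)%O -> exists i, raised x y i.
Proof.
move=> lt_xy; apply/existsP; apply: contraT => /existsPn nr.
have /CC_leP le_xy := ltW lt_xy; suff xy : x = y by rewrite xy ltxx in lt_xy.
by apply: CC_eqP => i; have := nr i; have := le_xy i; rewrite /raised; lia.
Qed.

(** The combinatorial heart of the theorem.  The pair [(u, v')] mixing the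
    two diagrams is always a diagram, so one may first bring [v] to [v'] and
    then [u] to [u'], each from left to right; the least label points at the
    next letter to change in this order. *)
Lemma raise_first x y i : (x <= y)%O -> raised x y i ->
  (forall k, raised x y k -> (comp_label x i <= comp_label x k)%O) ->
  exists z, (z <= y)%O /\ raises_only i x z.
Proof.
move=> /CC_leP le_xy ri min_i.
have [u [v [T xE dx]]] := CCP x; have [u' [v' [T' yE dy]]] := CCP y.
have eq_before k : (k < i)%N -> (CC_comp x k < 0)%R || (0 <= CC_comp x i)%R ->
  CC_comp x k = CC_comp y k.
  move=> lt_ki s_k; have := le_xy k.
  rewrite le_eqVlt => /orP[/eqP //|/min_i].
  rewrite comp_label_le /=; have -> : (i == k) = false.
    by apply/eqP => ik; rewrite ik ltnn in lt_ki.
  do 2 case: ifP; lia.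
have lt_in := ltn_ord i.
have ordJ j : (1 <= j < n)%N -> exists k : 'I_n.-1, j = k.+1.
  move=> Hj; have lt_j : (j.-1 < n.-1)%N by lia.
  by exists (Ordinal lt_j) => /=; lia.
have n0 : (0 < n)%N by lia.
have v1 : letter v 1 = letter v' 1.
  by case: T T' => _ dv _ [_ dv' _]; rewrite !letter_dual1.
have le_u j : (1 <= j <= n)%N -> (letter u j <= letter u' j)%N.
  move=> Hj; case: (ltnP j n) => [lt_jn|le_nj].
    have [|k ->] := ordJ j; first lia.
    by have := le_xy k; rewrite xE yE; have := dx k; have := dy k; lia.
  by case: T => tu _ _; have [|un _] := tu j; lia.
have le_v j : (1 <= j <= n)%N -> (letter v' j <= letter v j)%N.
  move=> Hj; case: (ltnP 1 j) => [lt_1j|le_j1]; last first.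
    by have -> : j = 1%N; rewrite ?v1; lia.
  have [|k kE] := ordJ j.-1; first lia.
  have -> : j = k.+2 by lia.
  by have := le_xy k; rewrite xE yE; have := dx k; have := dy k; lia.
have := ri; rewrite /raised xE yE => xyi.
have dxi := dx i; have dyi := dy i.
case: (ltP (CC_comp x i) 0%R) => [xi_neg|xi_pos].
(* The component [i] ends at [min(y_i, 0)], which is [- v'_(i+2)] as ordinals
   number components from 0; the letters of [v] before it are those of [v'],
   as components [k < i] that are nonnegative contribute zero letters on both sides. *)
- have H : tamari_interval_diagram u (set_letter v i.+2 (letter v' i.+2)).
    apply: (set_dual_interval T T') => //; first lia.
    move=> j Hj; case: (ltnP 1 j) => [lt_1j|le_j1]; last first.
      by have -> : j = 1%N; lia.
    have [|k kE] := ordJ j.-1; first lia.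
    have -> : j = k.+2 by lia.
    have := dx k; have := dy k; have := le_xy k.
    have := eq_before k; rewrite xE yE; lia.
  exists (CC_of H).
  have zE k : CC_comp (CC_of H) k
      = if k == i then (- (letter v' i.+2)%:Z)%R else CC_comp x k.
    rewrite CC_of_comp letter_set; last by have := ltn_ord k; lia.
    have -> : (k.+2 == i.+2) = (k == i) by [].
    by case: eqP => [->|_]; rewrite ?xE //; move: xi_neg; rewrite xE; lia.
  split; last first.
    split=> [|k /negPf nki]; last by rewrite zE nki.
    by rewrite /raised zE eqxx xE; move: xi_neg; rewrite xE; lia.
  apply/CC_leP => k; rewrite zE; case: eqP => [->|_]; last exact: le_xy.
  by rewrite yE; lia.
(* No negative component is raised, since its label would be less than that
   of [i]. *)
- have neg_eq k : (CC_comp x k < 0)%R -> CC_comp x k = CC_comp y k.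
    move=> xk; have := le_xy k; rewrite le_eqVlt => /orP[/eqP //|/min_i].
    rewrite comp_label_le /=; have -> : (i == k) = false.
      by apply/eqP => ik; move: xk; rewrite -ik; lia.
    do 2 case: ifP; lia.
  have H : tamari_interval_diagram (set_letter u i.+1 (letter u' i.+1)) v.
    apply: (set_tamari_interval T T') => //; first lia.
      move=> j Hj; have [|k kE] := ordJ j; first lia.
      rewrite kE; have := eq_before k; have := dx k; have := dy k.
      rewrite xE yE in xi_pos *; rewrite xE; lia.
    move=> j Hj; case: (ltnP 1 j) => [lt_1j|le_j1]; last first.
      by have -> : j = 1%N; lia.
    have [|k kE] := ordJ j.-1; first lia.
    have -> : j = k.+2 by lia.
    have := dx k; have := dy k; have := le_xy k.
    have := neg_eq k; rewrite xE yE; lia.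
  exists (CC_of H).
  have zE k : CC_comp (CC_of H) k = if k == i then CC_comp y i else CC_comp x k.
    rewrite CC_of_comp letter_set; last by have := ltn_ord k; lia.
    have -> : (k.+1 == i.+1) = (k == i) by [].
    by case: eqP => [->|_]; rewrite ?xE //; move: xi_pos; rewrite xE yE; lia.
  split; last first.
    split=> [|k /negPf nki]; last by rewrite zE nki.
    by rewrite /raised zE eqxx.
  by apply/CC_leP => k; rewrite zE; case: eqP => [->|_].
Qed.

(** * Covers *)

Definition weight x : int := (\sum_i CC_comp x i)%R.

Lemma weight_lt x y : (x < y)%O -> (weight x < weight y)%R.
Proof.
move=> lt_xy; have [i ri] := lt_raised lt_xy; have /CC_leP le_xy := ltW lt_xy.
rewrite /weight (bigD1 i) //= [ltRHS](bigD1 i) //=.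
by apply: ltr_leD => //; apply: ler_sum => k _; apply: le_xy.
Qed.

Lemma lt_cover x y : (x < y)%O -> exists2 z, covers x z & (z <= y)%O.
Proof.
have [m] := ubnP `|weight y - weight x|%N.
elim: m y => // m IHm y lt_m lt_xy.
have [c_xy|/asboolPn nc_xy] := boolP (covers x y); first by exists y.
have [z lt_xz lt_zy] : exists2 z, (x < z)%O & (z < y)%O.
  apply: contrapT => nz; apply: nc_xy; split=> // z [xz zy].
  by apply: nz; exists z.
have [|w c_xw le_wz] := IHm z _ lt_xz.
  by have := weight_lt lt_xz; have := weight_lt lt_zy; lia.
by exists w => //; apply: le_trans le_wz (ltW lt_zy).
Qed.

Lemma covers_lt x y : covers x y -> (x < y)%O.
Proof. by case/asboolP. Qed.

Lemma covers_between x y z : covers x y -> (x < z)%O -> (z <= y)%O -> z = y.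
Proof.
move=> /asboolP[_ nz] lt_xz; rewrite le_eqVlt => /orP[/eqP //|lt_zy].
by case: (nz z).
Qed.

Lemma raises_only_lt i x y : raises_only i x y -> (x < y)%O.
Proof.
case=> ri eq_xy; rewrite lt_neqAle; apply/andP; split.
  by apply/eqP => xy; move: ri; rewrite /raised xy ltxx.
by apply/CC_leP => k; case: (eqVneq k i) => [->|/eq_xy->//]; apply: ltW.
Qed.

Lemma raises_only_between i x y z :
  raises_only i x y -> (x < z)%O -> (z <= y)%O -> raises_only i x z.
Proof.
move=> [ri eq_xy] lt_xz /CC_leP le_zy; have /CC_leP le_xz := ltW lt_xz.
have eq_xz k : k != i -> CC_comp z k = CC_comp x k.
  by move=> nki; apply/le_anti; rewrite le_xz -(eq_xy k nki) le_zy.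
split=> //; have [k rk] := lt_raised lt_xz.
case: (eqVneq k i) => [<- //|/eq_xz eq_k].
by move: rk; rewrite /raised eq_k ltxx.
Qed.

Lemma first_cover x y : (x < y)%O ->
  exists i z, [/\ covers x z, (z <= y)%O, raises_only i x z
    & forall k, raised x y k -> (comp_label x i <= comp_label x k)%O].
Proof.
move=> lt_xy; have [i0 r0] := lt_raised lt_xy.
case: (arg_minP (comp_label x) r0) => i ri min_i.
have [z [le_zy oz]] := raise_first (ltW lt_xy) ri min_i.
have [w c_xw le_wz] := lt_cover (raises_only_lt oz).
exists i, w; split=> //; first exact: le_trans le_zy.
exact: raises_only_between oz (covers_lt c_xw) le_wz.
Qed.

(** The element given by [raise_first] between [x] and a cover of [x] must be
    that cover. *)
Lemma covers_raises_only x y : covers x y -> exists i, raises_only i x y.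
Proof.
move=> c_xy; have [i [z [_ le_zy oz _]]] := first_cover (covers_lt c_xy).
by exists i; rewrite -(covers_between c_xy (raises_only_lt oz) le_zy).
Qed.

(** Two elements that differ from [x] in the same component only are
    comparable. *)
Lemma cover_raising_unique i x y z :
  covers x y -> covers x z -> raises_only i x y -> raises_only i x z -> y = z.
Proof.
move=> c_xy c_xz [riy eq_y] [riz eq_z].
wlog le_i : y z c_xy c_xz riy eq_y riz eq_z
    / (CC_comp y i <= CC_comp z i)%R => [W|].
  case: (leP (CC_comp y i) (CC_comp z i)) => [|/ltW] le_i; first exact: W.
  by apply/esym/W.
apply: covers_between c_xz (covers_lt c_xy) _; apply/CC_leP => k.
by case: (eqVneq k i) => [->|nki] //; rewrite eq_y // eq_z.
Qed.

Lemma CC_label_raises_only i x y :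
  raises_only i x y -> CC_label x y = comp_label x i.
Proof.
case=> ri eq_xy; rewrite /CC_label; case: pickP => [k rk|/(_ i)]; last first.
  by rewrite -/(raised x y i) ri.
case: (eqVneq k i) => [->|/eq_xy eq_k] //.
by rewrite eq_k ltxx in rk.
Qed.

Lemma comp_label_inj x i y k : comp_label x i = comp_label y k -> i = k.
Proof. by case=> _ /ord_inj. Qed.

Lemma comp_label_raised x y i : raised x y i ->
  (comp_label x i < comp_label y i)%O.
Proof.
rewrite /raised => ri; rewrite lt_neqAle; apply/andP; split.
  by apply/eqP => -[_]; lia.
by rewrite comp_label_le /= eqxx; do 2 case: ifP; lia.
Qed.

Lemma comp_label_unraised x z i k : raises_only i x z -> k != i ->
  comp_label z k = comp_label x k.
Proof. by case=> _ eq_z /eq_z eq_k; rewrite /comp_label eq_k. Qed.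

(** * Saturated chains *)

Lemma saturated_chain_le x y s : saturated_chain x y s -> (x <= y)%O.
Proof.
elim: s x => [|z s IHs] x [] /=; first by move=> _ ->.
move=> /andP[c_xz p] l; apply: le_trans (ltW (covers_lt c_xz)) (IHs z _).
by split.
Qed.

Lemma saturated_chain_nil x s : saturated_chain x x s -> s = [::].
Proof.
case: s => // z s [] /= /andP[c_xz p] l.
have le_zx : (z <= x)%O by apply: (@saturated_chain_le z x s).
by have := lt_le_trans (covers_lt c_xz) le_zx; rewrite ltxx.
Qed.

Lemma saturated_chain_cons x y z s : saturated_chain x y (z :: s) ->
  [/\ covers x z, (z <= y)%O & saturated_chain z y s].
Proof.
by case=> /= /andP[c_xz p] l; split=> //; apply: (@saturated_chain_le _ _ s).
Qed.

Lemma saturated_chain_lt x y s : (x < y)%O -> saturated_chain x y s ->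
  exists i z s', [/\ s = z :: s', covers x z, raises_only i x z,
    raised x y i & saturated_chain z y s'].
Proof.
case: s => [|z s] lt_xy cs.
  by move: lt_xy; case: cs => _ /= ->; rewrite ltxx.
have [c_xz /CC_leP le_zy cs'] := saturated_chain_cons cs.
have [i oz] := covers_raises_only c_xz.
exists i, z, s; split=> //.
by case: oz => ri _; apply: lt_le_trans ri (le_zy i).
Qed.

(** Until the chain raises the component [i], this component, hence its
    label, stays that of [x]. *)
Lemma first_raise_label x y s i : saturated_chain x y s -> raised x y i ->
  comp_label x i \in chain_image (@CC_label n) x s.
Proof.
elim: s x => [|z s IHs] x.
  by case=> _ /= -> ; rewrite /raised ltxx.
move=> cs ri; have [c_xz le_zy cs'] := saturated_chain_cons cs.
have [k oz] := covers_raises_only c_xz.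
rewrite /chain_image /= in_cons (CC_label_raises_only oz).
case: (eqVneq i k) => [->|nik]; first by rewrite eqxx.
rewrite -(comp_label_unraised oz nik) [X in _ || X]IHs ?orbT //.
by case: oz => _ eq_z; rewrite /raised eq_z.
Qed.

(** This and [decreasing_head] determine the first step of a monotone chain:
    its label is one of those of the raised components, all of which occur in
    the chain. *)
Lemma increasing_head x y z s i :
  saturated_chain x y (z :: s) -> increasing_chain (@CC_label n) x (z :: s) ->
  raised x y i -> (CC_label x z <= comp_label x i)%O.
Proof.
move=> cs inc ri; have := first_raise_label cs ri.
rewrite /chain_image /= in_cons => /orP[/eqP-> //|in_s].
by have /allP/(_ _ in_s)/ltW := order_path_min lt_trans inc.
Qed.

Lemma decreasing_head x y z s i :
  saturated_chain x y (z :: s) -> decreasing_chain (@CC_label n) x (z :: s) ->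
  raised x y i -> (comp_label x i <= CC_label x z)%O.
Proof.
move=> cs dec ri; have := first_raise_label cs ri.
rewrite /chain_image /= in_cons => /orP[/eqP-> //|in_s].
have gtT : transitive (fun a b : Z3 => (b < a)%O).
  by move=> b a c ab bc; apply: lt_trans bc ab.
by have /allP/(_ _ in_s)/ltW := order_path_min gtT dec.
Qed.

(** * Increasing and decreasing chains *)

Theorem CC_EL_labeling : EL_labeling (@CC_label n).
Proof.
move=> x y; have [m] := ubnP `|weight y - weight x|%N.
elim: m x => // m IHm x lt_m; rewrite le_eqVlt => /orP[/eqP <-|lt_xy].
  by exists [::]; split=> // s' /saturated_chain_nil.
have [i [z [c_xz le_zy oz min_i]]] := first_cover lt_xy.
have ri : raised x y i.
  by case: oz => ri _; have /CC_leP le_zyi := le_zy; apply: lt_le_trans ri _.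
have [|s [cs inc uniq_s min_s]] := IHm z _ le_zy.
  have := weight_lt (covers_lt c_xz); move: le_zy; rewrite le_eqVlt.
  by case/orP=> [/eqP->|/weight_lt]; lia.
have E : CC_label x z = comp_label x i := CC_label_raises_only oz.
exists (z :: s); split.
- by case: cs => p l; split=> //=; rewrite c_xz.
(* The next label is that of the same component at a larger value, or that of
   another component which [x] and [z] share. *)
- rewrite /increasing_chain /chain_image /=.
  case: s cs inc {uniq_s min_s} => [|w s] //= cs inc; apply/andP; split=> //.
  have [c_zw /CC_leP le_wy _] := saturated_chain_cons cs.
  have [k ow] := covers_raises_only c_zw.
  rewrite E (CC_label_raises_only ow).
  case: (eqVneq k i) => [->|nki]; first by apply: comp_label_raised; case: oz.
  rewrite (comp_label_unraised oz nki) lt_neqAle; apply/andP; split.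
    by apply/eqP => /comp_label_inj ik; rewrite ik eqxx in nki.
  apply: min_i; case: ow oz => rk _ [_ /(_ k nki) eq_k].
  by rewrite /raised -eq_k; apply: lt_le_trans rk (le_wy k).
- move=> s' cs' inc'.
  have [k [w [s1 [Es c_xw ow rk cs1]]]] := saturated_chain_lt lt_xy cs'.
  subst s'; have := increasing_head cs' inc' ri.
  rewrite (CC_label_raises_only ow) => le_ki.
  have ki : k = i.
    by apply: (@comp_label_inj x _ x); apply/le_anti; rewrite le_ki min_i.
  subst k; have wz := cover_raising_unique c_xw c_xz ow oz; subst w.
  by congr cons; apply: uniq_s => //; apply: path_sorted inc'.
- move=> s' cs' ne_s.
  have [k [w [s1 [Es c_xw ow rk cs1]]]] := saturated_chain_lt lt_xy cs'.
  subst s'; rewrite /chain_smaller /chain_image /= ltxi_cons.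
  rewrite E (CC_label_raises_only ow) min_i //=.
  case: (eqVneq k i) => [ki|nki].
    subst k; have wz := cover_raising_unique c_xw c_xz ow oz; subst w.
    by rewrite lexx; apply: min_s => // ss; apply: ne_s; rewrite ss.
  apply/implyP => le_ki; case/eqP: nki; apply: (@comp_label_inj x _ x).
  by apply/le_anti; rewrite le_ki min_i.
Qed.

Theorem decreasing_chain_unique x y s1 s2 :
  saturated_chain x y s1 -> decreasing_chain (@CC_label n) x s1 ->
  saturated_chain x y s2 -> decreasing_chain (@CC_label n) x s2 -> s1 = s2.
Proof.
elim: s1 x s2 => [|z1 s1 IHs] x s2 cs1.
  by case: (cs1) => _ /= -> _ /saturated_chain_nil.
have [c_1 le_1 _] := saturated_chain_cons cs1.
have lt_xy := lt_le_trans (covers_lt c_1) le_1.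
have [i [z [s [[<- <-] _ o1 ri cs1']]]] := saturated_chain_lt lt_xy cs1.
move=> dec1 cs2 dec2.
have [k [z2 [s' [Es c_2 o2 rk cs2']]]] := saturated_chain_lt lt_xy cs2.
subst s2; have le_ki := decreasing_head cs1 dec1 rk.
have le_ik := decreasing_head cs2 dec2 ri.
have ik : i = k.
  apply: (@comp_label_inj x _ x); apply/le_anti.
  rewrite (CC_label_raises_only o1) in le_ki.
  by rewrite (CC_label_raises_only o2) in le_ik; rewrite le_ik.
subst k; have z12 := cover_raising_unique c_1 c_2 o1 o2; subst z2.
congr cons; apply: (IHs z1) => //.
  exact: path_sorted dec1.
exact: path_sorted dec2.
Qed.

End Labels.

Theorem theorem3p5p1 (n : nat) (hn : (1 <= n)%N) :
  EL_labeling (@CC_label n) /\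
  (forall (x y : CC n) (s1 s2 : seq (CC n)),
     saturated_chain x y s1 -> decreasing_chain (@CC_label n) x s1 ->
     saturated_chain x y s2 -> decreasing_chain (@CC_label n) x s2 ->
     s1 = s2).
Proof. by split; [exact: CC_EL_labeling | exact: decreasing_chain_unique]. Qed.
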